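(* There exist a simply connected locally finite combinatorial $2$-complex $X$, a disk map $D\to X^{\pm,2}$ with unfolding $D'=\operatorname{unf}_2(D)$, and a nonempty dual-connected hole-free face-set $A'\subseteq F(D')$ such that $\operatorname{coll}_2(A')$ is dual-connected but not hole-free in $D$. In particular, the implication ''$A'$ dual-connected and hole-free in $D'$ $\Longrightarrow$ $\operatorname{coll}_M(A')$ hole-free in $D$'' is false in general.
   Context: A disk diagram $D$ is a finite, connected, simply connected planar $2$-complex embedded in the plane; its $1$-skeleton may have multi-edges but no loop edges; $F(D)$ is its set of faces. A disk map $D\to Z$ to a combinatorial $2$-complex is a cellular map from a disk diagram mapping open cells homeomorphically onto open cells and respecting attaching maps. A face-set $A\subseteq F(D)$ is dual-connected if it is connected in the face-dual graph (faces adjacent when they share an edge). Its carrier $\Sigma_A$ is the closed subcomplex of the faces of $A$ with all incident edges and vertices; $A$ is hole-free if $\Sigma_A$ has no bounded complementary components (every component of the complement of $|\Sigma_A|$ in $S^2$ is the one containing the exterior of $D$). The free completion $X^{\pm}$ is obtained from $X$ by attaching for each unoriented edge (orientation $e$) one $2$-cell (free bigon) along $e\bar e$. For $M\ge 1$ the $M$-path completion $X^{\pm,M}$ is obtained from $X^{\pm}$ by adjoining, for every oriented edge-path $p=e_1\cdots e_m$ in $X^{(1)}$ with $2\le m\le M$, a single $2$-cell $B_p$ attached along $p\,p^{-1}$; a face of $D$ mapping to such $B_p$ is a path-bigon face of path-length $m$. For a disk map $D\to X^{\pm,M}$, the unfolding $D'=\operatorname{unf}_M(D)\to X^{\pm}$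 is obtained by replacing each path-bigon face $\sigma$ of path-length $\ell(\sigma)\in\{2,\dots,M\}$ (mapping to $B_p$, $p=e_1\cdots e_\ell$) by the canonical chain $C_\sigma$ of $\ell(\sigma)$ ordinary free bigons, consecutive ones meeting in a vertex, with the same attaching walk, the $t$-th bigon filling the backtracking pair $e_t\bar e_t$; all other faces are unchanged. When $\ell(\sigma)=1$, $C_\sigma=\{\sigma\}$. The face-collapse map $\pi_M:F(D')\to F(D)$ is $\pi_M(f)=\sigma$ if $f\in F(C_\sigma)$ and $\pi_M(f)=f$ otherwise; $\operatorname{coll}_M(A'):=\pi_M(A')$. *)

(* Defs.v *)
From Stdlib Require Import Relation_Operators Relation_Definitions.
From Stdlib Require List.
From mathcomp Require Import all_boot.

Set Implicit Arguments.
Unset Strict Implicit.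
Unset Printing Implicit Defensive.

(* [edge] is the type of unoriented edges, and [(e, true)], [(e, false)] are   *)
(* the two orientations of [e]; fixing which one is [true] is only a naming    *)
(* convention. [bnd f] is the attaching walk of the 2-cell [f].                *)
Record complex2 : Type := Complex2 {
  vert : Type;
  edge : Type;
  face : Type;
  src : edge * bool -> vert;
  bnd : face -> seq (edge * bool)
}.

Definition oedge (K : complex2) : Type := (edge K * bool)%type.

Definition opp (E : Type) (d : E * bool) : E * bool := (d.1, ~~ d.2).

Definition opp_path (E : Type) (p : seq (E * bool)) : seq (E * bool) :=
  rev (map (@opp E) p).

Definition tgt (K : complex2) (d : oedge K) : vert K := src (opp d).

Fixpoint walk (K : complex2) (x : vert K) (p : seq (oedge K)) (y : vert K)
    : Prop :=
  if p is d :: p' then src d = x /\ walk (tgt d) p' y else x = y.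

Definition edge_path (K : complex2) (p : seq (oedge K)) : Prop :=
  exists x y : vert K, walk x p y.

Definition combinatorial_complex (K : complex2) : Prop :=
  forall f : face K, bnd f <> [::] /\ exists x : vert K, walk x (bnd f) x.

Inductive homotopy_step (K : complex2) (x y : vert K)
    : seq (oedge K) -> seq (oedge K) -> Prop :=
| step_spur p q d :
    walk x (p ++ q) y -> walk x (p ++ [:: d; opp d] ++ q) y ->
    homotopy_step x y (p ++ q) (p ++ [:: d; opp d] ++ q)
| step_cell p q f :
    walk x (p ++ q) y -> walk x (p ++ bnd f ++ q) y ->
    homotopy_step x y (p ++ q) (p ++ bnd f ++ q).

Definition homotopic (K : complex2) (x y : vert K) : relation (seq (oedge K)) :=
  clos_refl_sym_trans _ (@homotopy_step K x y).

Definition connected (K : complex2) : Prop :=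
  inhabited (vert K) /\ forall x y : vert K, exists p, walk x p y.

Definition simply_connected (K : complex2) : Prop :=
  connected K /\
  forall (x : vert K) (p : seq (oedge K)), walk x p x -> homotopic x x p [::].

Definition locally_finite (K : complex2) : Prop :=
  forall v : vert K,
    (exists s : seq (oedge K), forall d, src d = v -> List.In d s) /\
    (exists s : seq (face K), forall f : face K,
       (exists2 d, List.In d (bnd f) & src d = v) -> List.In f s).

Definition free_completion (X : complex2) : complex2 :=
  @Complex2 (vert X) (edge X) (face X + edge X)%type (@src X)
    (fun c => match c with
              | inl f => bnd f
              | inr e => [:: (e, true); (e, false)]
              end).

Definition path_le (X : complex2) (M : nat) : Type :=
  {p : seq (oedge X) | edge_path p /\ 2 <= size p <= M}.

Definition path_completion (M : nat) (X : complex2) : complex2 :=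
  @Complex2 (vert X) (edge X) (face (free_completion X) + path_le X M)%type
    (@src X)
    (fun c => match c with
              | inl f => @bnd (free_completion X) f
              | inr p => sval p ++ opp_path (sval p)
              end).

Definition path_length (X : complex2) (M : nat)
    (c : face (path_completion M X)) : nat :=
  if c is inr p then size (sval p) else 1.

(* A finite 2-complex embedded in the oriented sphere, as a combinatorial map: *)
(* [pnext] sends a dart (oriented edge) to its successor on the boundary walk  *)
(* of the complementary region of the 1-skeleton that lies on its left. A      *)
(* face is such a region, designated by one dart [pbase f] of its boundary.    *)
Record plane_complex : Type := PlaneComplex {
  pvert : finType;
  pedge : finType;
  pface : finType;
  psrc : pedge * bool -> pvert;
  pnext : pedge * bool -> pedge * bool;
  pbase : pface -> pedge * bool
}.

Definition dart (D : plane_complex) : finType := (pedge D * bool)%type.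

Coercion complex_of (D : plane_complex) : complex2 :=
  @Complex2 (pvert D) (pedge D) (pface D) (@psrc D)
    (fun f => orbit (@pnext D) (pbase f)).

(* Regions of the sphere minus the 1-skeleton: [None] is the exterior one.     *)
Definition region (D : plane_complex) : finType := option (pface D).

Definition borders (D : plane_complex) (d : dart D) (r : region D) : bool :=
  if r is Some f then d \in orbit (@pnext D) (pbase f)
  else [forall f : pface D, d \notin orbit (@pnext D) (pbase f)].

(* A simply connected planar complex has connected complement, so there is     *)
(* just one region which is not a face; together with the faces and the edges  *)
(* it makes up a cellulation of an orientable closed surface, which is the     *)
(* sphere by Euler's formula. The orbits of [pnext \o opp] are the rotations   *)
(* of the darts around the vertices.                                           *)
Record disk_diagram (D : plane_complex) : Prop := DiskDiagram {
  dd_next_inj : injective (@pnext D);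
  dd_vertex : forall d d' : dart D,
    fconnect (fun b : dart D => pnext (opp b)) d d' = (psrc d == psrc d');
  dd_face : forall f g : pface D,
    fconnect (@pnext D) (pbase f) (pbase g) -> f = g;
  dd_exterior : forall d d' : dart D,
    borders d None -> borders d' None -> fconnect (@pnext D) d d';
  dd_euler : #|pvert D| + #|pface D|.+1 = #|pedge D| + 2;
  dd_simply_connected : simply_connected D;
  dd_no_loop : forall d : dart D, psrc d <> psrc (opp d)
}.

Definition on_edge (D : plane_complex) (e : pedge D) (f : pface D) : bool :=
  borders ((e, true) : dart D) (Some f) || borders ((e, false) : dart D) (Some f).

Definition dual_adj (D : plane_complex) : rel (pface D) :=
  fun f g => [exists e : pedge D, on_edge e f && on_edge e g].

Definition dual_connected (D : plane_complex) (A : {set pface D}) : Prop :=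
  forall f g, f \in A -> g \in A ->
    connect [rel h k | [&& h \in A, k \in A & dual_adj h k]] f g.

(* The open cells of the sphere cellulated by [D] and its exterior region.     *)
Definition cell (D : plane_complex) : finType :=
  (pvert D + pedge D + region D)%type.

Definition vcell (D : plane_complex) (v : pvert D) : cell D := inl (inl v).
Definition ecell (D : plane_complex) (e : pedge D) : cell D := inl (inr e).
Definition rcell (D : plane_complex) (r : region D) : cell D := inr r.

(* [incident c c']: [c] lies in the frontier of [c']. A vertex without darts   *)
(* (the one-vertex diagram) lies in the frontier of the exterior.              *)
Definition incident (D : plane_complex) (c c' : cell D) : bool :=
  match c, c' with
  | inl (inl v), inl (inr e) => (psrc (e, true) == v) || (psrc (e, false) == v)
  | inl (inl v), inr r =>
      [exists d : dart D, borders d r && (psrc d == v)] ||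
      (r == None) && [forall d : dart D, psrc d != v]
  | inl (inr e), inr r =>
      borders ((e, true) : dart D) r || borders ((e, false) : dart D) r
  | _, _ => false
  end.

Definition carrier (D : plane_complex) (A : {set pface D}) : {set cell D} :=
  [set c | [exists f in A, (c == rcell (Some f)) ||
                           incident c (rcell (Some f))]].

(* The complement of the carrier is an open union of open cells; two of its    *)
(* cells are in the same component iff they are linked by a chain of cells of  *)
(* the complement, each one lying in the frontier of the next or conversely.   *)
Definition hole_free (D : plane_complex) (A : {set pface D}) : Prop :=
  forall c : cell D, c \notin carrier A ->
    connect [rel b b' | [&& b \notin carrier A, b' \notin carrier A &
                            incident b b' || incident b' b]]
      c (rcell None).

(* A map of 2-complexes carrying open cells homeomorphically onto open cells.  *)
(* On a face [f] it is given, up to isotopy, by the side [fstart f] of [f] and *)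
(* the direction [forient f] from which the attaching walk of the image cell   *)
(* is read; the image cell alone need not determine them.                      *)
Record cell_map (D : plane_complex) (Y : complex2) : Type := CellMap {
  vmap : pvert D -> vert Y;
  emap : dart D -> oedge Y;
  fmap : pface D -> face Y;
  fstart : pface D -> dart D;
  forient : pface D -> bool
}.

(* The sides of [f], each taken with [f] on its left, in the order in which    *)
(* the attaching walk of the image of [f] meets them.                          *)
Definition sides (D : plane_complex) (Y : complex2) (phi : cell_map D Y)
    (f : pface D) : seq (dart D) :=
  let c := orbit (@pnext D) (fstart phi f) in
  if forient phi f then c else rev c.

Record disk_map (D : plane_complex) (Y : complex2) (phi : cell_map D Y)
    : Prop := DiskMap {
  dm_diagram : disk_diagram D;
  dm_src : forall d : dart D, src (emap phi d) = vmap phi (psrc d);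
  dm_opp : forall d : dart D, emap phi (opp d) = opp (emap phi d);
  dm_start : forall f : pface D, borders (fstart phi f) (Some f);
  dm_attach : forall f : pface D,
    [seq emap phi (if forient phi f then d else opp d) | d <- sides phi f] =
    bnd (fmap phi f)
}.

Section Unfolding.

Variables (X : complex2) (M : nat) (D : plane_complex).
Variable phi : cell_map D (path_completion M X).

Definition flength (s : pface D) : nat := path_length (fmap phi s).

(* The boundary walk of a path-bigon face of path-length [l] is cut into       *)
(* the walks of length two formed by its [t]-th and [2l + 1 - t]-th sides.     *)
Definition unf_next (d : dart D) : dart D :=
  if [pick s : pface D | (1 < flength s) && borders d (Some s)] is Some s
  then nth d (rev (sides phi s)) (index d (sides phi s))
  else pnext d.

(* This forces the end of each side to agree with the origin of its new        *)
(* successor: the [t]-th and [2l - t]-th vertices of a path-bigon face are     *)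
(* identified.                                                                 *)
Definition glue : rel (pvert D) :=
  fun v w => [exists d : dart D,
    (v == psrc (opp d)) && (w == psrc (unf_next d)) ||
    (w == psrc (opp d)) && (v == psrc (unf_next d))].

Lemma glue_connect_sym : connect_sym glue.
Proof.
apply: sym_connect_sym => v w.
by apply: eq_existsb => d; rewrite orbC.
Qed.

Definition unf_vert : finType := {v : pvert D | roots glue v}.

Definition unf_proj (v : pvert D) : unf_vert :=
  exist _ (root glue v) (roots_root glue_connect_sym v).

(* The pair [(s, t)] is the bigon number [t] (from 0) of the chain of [s].     *)
Definition unf_face : finType := {s : pface D & 'I_(flength s)}.

Definition collapse (f : unf_face) : pface D := tag f.

Definition side_of (f : unf_face) : dart D :=
  nth (fstart phi (tag f)) (sides phi (tag f)) (tagged f).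

Definition unf_base (f : unf_face) : dart D :=
  if 1 < flength (tag f) then side_of f else pbase (tag f).

Definition unf : plane_complex :=
  @PlaneComplex unf_vert (pedge D) unf_face
    (fun d => unf_proj (psrc d)) unf_next unf_base.

Definition unf_fmap (f : unf_face) : face (free_completion X) :=
  match fmap phi (tag f) with
  | inl c => c
  | inr _ => inr (emap phi (side_of f)).1
  end.

(* The attaching walk of the free bigon of [e] starts with [(e, true)].        *)
Definition unf_fstart (f : unf_face) : dart D :=
  if 1 < flength (tag f) then
    if (emap phi (side_of f)).2 then side_of f else unf_next (side_of f)
  else fstart phi (tag f).

Definition unf_map : cell_map unf (free_completion X) :=
  @CellMap unf (free_completion X) (fun v => vmap phi (val v)) (emap phi)
    unf_fmap unf_fstart (fun f => forient phi (tag f)).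

Definition coll (A : {set pface unf}) : {set pface D} :=
  [set collapse f | f in A].

End Unfolding.

(* Main.v *)
Require Import Defs.
From Stdlib Require Import Relation_Operators.
From mathcomp Require Import all_boot.

Set Implicit Arguments.
Unset Strict Implicit.
Unset Printing Implicit Defensive.

(** Pinching can open a wall: a path-bigon face of [D] may separate the sphere
while only one half of its chain belongs to [A'], and the other half, together
with its sides, is then a passage through the wall.

Let [X] be a single edge [a], and let [p] be the backtracking path [a a^-1], so
that the path-bigon along [p] has attaching walk [a a^-1 a a^-1]. In the plane,
draw a disk whose boundary is a pair of parallel edges between [c] and [u], and
inside it a second pair of parallel edges between [c] and a vertex [w], which
bounds a smaller disk, the hole. The region between the two circles is an
annulus pinched at [c]; its boundary walk goes once around each circle, has
length four, and maps to [p p^-1]. This region is the path-bigon face, the hole is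
an ordinary free bigon, and the whole is a diagram [D] with two faces. The
carrier of the path-bigon face contains both circles, hence cuts the hole off
from the exterior.

The unfolding identifies [u] with [w] and leaves four parallel edges from [c] to
that vertex. They cut the sphere into four bigons which are, in cyclic order, the
hole, the first bigon of the chain, the exterior, the second bigon of the chain.
For [A'] reduced to the first bigon, one still reaches the exterior from the hole
through the second one: [A'] is hole-free ([first_bigon_hole_free]). Its collapse
is the path-bigon face, which is not ([pinched_face_not_hole_free]). Both
face-sets have one element, so dual-connectedness is immediate.

Most of the work is the verification that both combinatorial maps are disk
diagrams ([pinched_diagram], [unfolded_diagram]). Simple connectedness is reduced
by [simply_connected_retract] to one homotopy for each edge. *)

(** * Homotopy of edge-paths *)

Section Homotopy.

Variable K : complex2.
Implicit Types (x y z : vert K) (d : oedge K) (p q s : seq (oedge K)).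

Lemma oppK : involutive (@opp (edge K)).
Proof. by case=> e b; rewrite /opp /= negbK. Qed.

Lemma walk_cat x y z p q : walk x p y -> walk y q z -> walk x (p ++ q) z.
Proof.
by elim: p x => [|d p IHp] x /= => [-> | [-> /IHp walk_p] /walk_p].
Qed.

Lemma walk_opp_path x y p : walk x p y -> walk y (opp_path p) x.
Proof.
elim: p x => [|d p IHp] x /= => [-> // | [<- /IHp walk_p]].
rewrite /opp_path /= rev_cons -cats1.
by apply: walk_cat walk_p _; rewrite /= /tgt oppK.
Qed.

Lemma homotopic_refl x y p : homotopic x y p p.
Proof. exact: rst_refl. Qed.

Lemma homotopic_sym x y p q : homotopic x y p q -> homotopic x y q p.
Proof. exact: rst_sym. Qed.

Lemma homotopic_trans x y q p s :
  homotopic x y p q -> homotopic x y q s -> homotopic x y p s.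
Proof. exact: rst_trans. Qed.

Lemma homotopic_cons d y p q :
  homotopic (tgt d) y p q -> homotopic (src d) y (d :: p) (d :: q).
Proof.
elim=> [p1 p2 step | p1 | p1 p2 _ | p1 p2 p3 _ h12 _ h23].
- apply: rst_step; case: step => [p' q' d' w1 w2 | p' q' f w1 w2].
    exact: (@step_spur K _ _ (d :: p') q' d').
  exact: (@step_cell K _ _ (d :: p') q' f).
- exact: homotopic_refl.
- exact: homotopic_sym.
- exact: homotopic_trans h12 h23.
Qed.

Lemma homotopic_cat x y z p q s :
  walk y s z -> homotopic x y p q -> homotopic x z (p ++ s) (q ++ s).
Proof.
move=> walk_s; elim=> [p1 p2 step | p1 | p1 p2 _ | p1 p2 p3 _ h12 _ h23].
- apply: rst_step; case: step => [p' q' d' w1 w2 | p' q' f w1 w2].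
    rewrite -!catA; apply: (@step_spur K _ _ p' (q' ++ s) d').
      by rewrite catA; apply: walk_cat w1 walk_s.
    by move: (walk_cat w2 walk_s); rewrite -!catA.
  rewrite -!catA; apply: (@step_cell K _ _ p' (q' ++ s) f).
    by rewrite catA; apply: walk_cat w1 walk_s.
  by move: (walk_cat w2 walk_s); rewrite -!catA.
- exact: homotopic_refl.
- exact: homotopic_sym.
- exact: homotopic_trans h12 h23.
Qed.

Lemma homotopic_catl x y z p q s :
  walk x p y -> homotopic y z q s -> homotopic x z (p ++ q) (p ++ s).
Proof.
elim: p x => [|d p IHp] x /= => [-> // | [<- walk_p hom_qs]].
exact/homotopic_cons/(IHp _ walk_p).
Qed.

Lemma homotopic_spur d y p :
  walk (src d) p y -> homotopic (src d) y (d :: opp d :: p) p.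
Proof.
move=> walk_p; apply/homotopic_sym/rst_step/(@step_spur K _ _ [::] p d) => //=.
by rewrite /tgt oppK.
Qed.

Lemma homotopic_opp_path x y p :
  walk x p y -> homotopic x x (p ++ opp_path p) [::].
Proof.
elim: p x => [|d p IHp] x /=; first by move=> _; apply: homotopic_refl.
case=> <- /IHp hom_p; rewrite /opp_path /= rev_cons -cats1 catA.
apply: homotopic_trans (homotopic_spur (p := [::]) (erefl (src d))).
apply: (@homotopic_cons d _ _ ([::] ++ [:: opp d])).
by apply: homotopic_cat hom_p; rewrite /= /tgt oppK.
Qed.

(** A closed walk at [x] followed by [r x] is homotopic to [r x], because the
edges of the walk can be absorbed one by one, from the last one on, into the
paths [r] that lead to the base point. An edge which is absorbed in one direction
is absorbed in the other one too, up to a spur. Taking [r] along a spanning tree,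
what remains to prove is one homotopy for each edge outside of the tree. *)
Lemma simply_connected_retract (x0 : vert K) (r : vert K -> seq (oedge K)) :
    (forall x, walk x (r x) x0) ->
    (forall e, homotopic (src (e, true)) x0
                 ((e, true) :: r (src (e, false))) (r (src (e, true)))) ->
  simply_connected K.
Proof.
move=> walk_r absorb_fwd; split.
  split=> // x y; exists (r x ++ opp_path (r y)).
  exact: walk_cat (walk_r x) (walk_opp_path (walk_r y)).
have absorb d : homotopic (src d) x0 (d :: r (tgt d)) (r (src d)).
  case: d => e [|]; first exact: absorb_fwd.
  have := homotopic_cons (d := (e, false)) (absorb_fwd e).
  move/homotopic_sym/homotopic_trans; apply.
  exact: homotopic_spur.
have absorb_walk x y p : walk x p y -> homotopic x x0 (p ++ r y) (r x).
  elim: p x => [|d p IHp] x /= => [-> | [<- /IHp hom_p]].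
    exact: homotopic_refl.
  exact: homotopic_trans (homotopic_cons hom_p) (absorb d).
move=> x p walk_p; have spur_r := homotopic_opp_path (walk_r x).
apply: homotopic_trans spur_r.
apply: homotopic_trans (homotopic_cat (walk_opp_path (walk_r x))
                          (absorb_walk _ _ _ walk_p)).
rewrite -catA -[X in homotopic x x X _]cats0.
exact/homotopic_catl/homotopic_sym/homotopic_opp_path.
Qed.

(** For two edges with the same ends, filling the bigon between them amounts to a
homotopy; in this form bigons can be composed. *)
Definition parallel d d' : Prop :=
  [/\ src d = src d', tgt d = tgt d'
    & homotopic (src d) (tgt d) [:: d] [:: d']].

Lemma parallel_refl d : parallel d d.
Proof. by split=> //; apply: homotopic_refl. Qed.

Lemma parallel_sym d d' : parallel d d' -> parallel d' d.
Proof.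
case=> src_eq tgt_eq hom; split=> //; rewrite -src_eq -tgt_eq.
exact: homotopic_sym.
Qed.

Lemma parallel_trans d' d d2 : parallel d d' -> parallel d' d2 -> parallel d d2.
Proof.
case=> src1 tgt1 hom1 [src2 tgt2 hom2].
split; [exact: etrans src2 | exact: etrans tgt2 |].
by apply: homotopic_trans hom1 _; rewrite src1 tgt1.
Qed.

Lemma homotopic_parallel d d' :
  parallel d d' -> homotopic (src d) (src d) [:: d; opp d'] [::].
Proof.
case=> src_eq tgt_eq hom.
have walk_opp : walk (tgt d) [:: opp d'] (src d).
  by split; [rewrite tgt_eq | rewrite src_eq /tgt oppK].
apply: homotopic_trans (homotopic_cat walk_opp hom) _.
rewrite src_eq; exact: (homotopic_spur (p := [::])).
Qed.

Lemma homotopic_cell f x y p :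
  walk x (bnd f) x -> walk x p y -> homotopic x y (bnd f ++ p) p.
Proof.
move=> walk_f walk_p.
apply/rst_sym/rst_step/(@step_cell K _ _ [::] p f) => //=.
exact: walk_cat walk_p.
Qed.

Lemma parallel_bigon f d d' :
  src d = src d' -> tgt d = tgt d' -> bnd f = [:: d; opp d'] -> parallel d d'.
Proof.
move=> src_eq tgt_eq bnd_f; split=> //.
have walk_f : walk (src d) (bnd f) (src d).
  by rewrite bnd_f src_eq; split; [|split; rewrite /tgt ?oppK].
have walk_d' : walk (src d) [:: d'] (tgt d) by rewrite src_eq tgt_eq.
apply: homotopic_trans (homotopic_cell walk_f walk_d').
rewrite bnd_f; apply: (@homotopic_cons d _ [::] [:: opp d'; d']).
apply: homotopic_sym; rewrite tgt_eq -[X in [:: _; X]]oppK.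
exact: (homotopic_spur (p := [::])).
Qed.

Lemma parallel_opp d d' : parallel d d' -> parallel (opp d) (opp d').
Proof.
move=> par; have hom := homotopic_parallel par.
case: par => src_eq tgt_eq _; split; rewrite /tgt ?oppK //.
apply: homotopic_trans (_ : homotopic _ _ [:: opp d; d; opp d'] _).
  apply: homotopic_sym.
  apply: (@homotopic_cons (opp d) _ [:: d; opp d'] [::]).
  by rewrite /tgt oppK.
have walk_d' : walk (src (opp d)) [:: opp d'] (src d).
  by split; rewrite /tgt ?oppK.
by have := homotopic_spur walk_d'; rewrite oppK.
Qed.

End Homotopy.

(** This determines an orbit by evaluating [f] along the cycle only. *)
Lemma orbit_fcycle (T : finType) (f : T -> T) x p :
  fcycle f (x :: p) -> uniq (x :: p) -> orbit f x = x :: p.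
Proof.
by move=> cyc_p uniq_p; rewrite (orbitE cyc_p uniq_p) ?mem_head //= eqxx rot0.
Qed.

(** * The diagram *)

(** The complex with one edge, from [false] to [true], and no face. *)
Definition segment : complex2 :=
  @Complex2 bool unit void (fun d => ~~ d.2) (fun f => match f with end).

Lemma segment_combinatorial : combinatorial_complex segment.
Proof. by case. Qed.

Lemma segment_simply_connected : simply_connected segment.
Proof.
apply: (@simply_connected_retract segment false
          (fun x => if x then [:: (tt, false)] else [::])); first by case.
by case; apply: (@homotopic_spur segment (tt, true) _ [::]).
Qed.

Lemma segment_locally_finite : locally_finite segment.
Proof.
move=> v; split; last by exists [::]; case.
exists [:: (tt, true); (tt, false)].
by case=> [[] []] _ /=; [left | right; left].
Qed.

(** [None] is the pinching point and [Some b] the other vertex on the circle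
around the hole ([b = true]) or on the circle along the exterior ([b = false]).
The edge [(b, i)] goes from [None] to [Some b]; it bounds the first ([i = true])
or the second ([i = false]) bigon of the chain once the diagram is unfolded. The
faces are [true], the pinched annulus, and [false], the hole. *)
Definition pinched_src (d : bool * bool * bool) : option bool :=
  let: (b, i, o) := d in if o then None else Some b.

Definition pinched_next (d : bool * bool * bool) : bool * bool * bool :=
  let: (b, i, o) := d in if o then (b, ~~ i, false) else (i, ~~ b, true).

Definition pinched_base (f : bool) : bool * bool * bool :=
  if f then (true, true, true) else (true, false, true).

Definition pinched : plane_complex :=
  @PlaneComplex (option bool : finType) (bool * bool : finType)%type bool
    pinched_src pinched_next pinched_base.

(** The path runs along the edge and back: the sides of the pinched annulus
alternately leave the pinching point and return to it. *)
Definition backtrack : Defs.path_le segment 2.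
Proof.
exists [:: (tt, true); (tt, false)]; split=> //; by exists false, false.
Defined.

Definition pinched_map : cell_map pinched (path_completion 2 segment) :=
  @CellMap pinched (path_completion 2 segment)
    isSome
    (fun d => (tt, d.2))
    (fun f => if f then inr backtrack else inl (inr tt))
    pinched_base
    (fun _ => true).

Lemma pinched_face_orbit f : orbit (@pnext pinched) (pbase f) =
  if f then [:: (true, true, true); (true, false, false);
                (false, false, true); (false, true, false)]
  else [:: (true, false, true); (true, true, false)].
Proof. by case: f; apply: orbit_fcycle. Qed.

Lemma pinched_simply_connected : simply_connected pinched.
Proof.
apply: (@simply_connected_retract pinched None
          (fun x => if x is Some b then [:: (b, true, false)] else [::])).
  by case.
have par_hole : @parallel pinched (true, false, true) (true, true, true).
  by apply: (@parallel_bigon pinched false) => //; apply: pinched_face_orbit.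
case=> [[] []]; try exact: (@homotopic_spur pinched _ _ [::]).
  exact: homotopic_parallel par_hole.
(* The exterior circle: join it to the circle around the hole by a spur, and    *)
(* push that circle across the hole; the result bounds the pinched annulus.     *)
pose rest : seq (dart pinched) :=
  [:: (true, false, false); (false, false, true); (false, true, false)].
apply: (@homotopic_trans pinched None None ((true, false, true) :: rest)).
  exact/homotopic_sym/(@homotopic_spur pinched (true, false, true)).
case: par_hole => _ _ /(@homotopic_cat pinched _ _ None _ _ rest) hom.
apply: homotopic_trans (hom _) _; first by [].
have := @homotopic_cell pinched true None None [::].
by rewrite [bnd _]pinched_face_orbit; apply.
Qed.

Lemma pinched_diagram : disk_diagram pinched.
Proof.
split.
- by move=> [[[] []] []] [[[] []] []].
- move=> d d'; rewrite fconnect_orbit.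
  have -> : orbit (fun b : dart pinched => pnext (opp b)) d =
    let: (b, i, o) := d in
    if o then
      [:: (b, i, true); (i, ~~ b, true); (~~ b, ~~ i, true); (~~ i, b, true)]
    else [:: (b, i, false); (b, ~~ i, false)].
    by case: d => [[[] []] []]; apply: orbit_fcycle.
  by case: d => [[[] []] []]; case: d' => [[[] []] []].
- by move=> f g; rewrite fconnect_orbit pinched_face_orbit; case: f; case: g.
- have ext (d : dart pinched) :
      borders d None -> d \in [:: (false, true, true); (false, false, false)].
    move=> /forallP out; have := out true; have := out false.
    by rewrite !pinched_face_orbit; case: d {out} => [[[] []] []].
  move=> d d' /ext ext_d /ext; rewrite fconnect_orbit.
  have -> : orbit (@pnext pinched) d = [:: d; pinched_next d].
    by case: d ext_d => [[[] []] []] // _; apply: orbit_fcycle.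
  by case: d ext_d => [[[] []] []] // _; case: d' => [[[] []] []].
- by rewrite card_option card_bool card_prod card_bool.
- exact: pinched_simply_connected.
- by case=> [[[] []] []].
Qed.

Lemma pinched_disk_map : disk_map pinched_map.
Proof.
split.
- exact: pinched_diagram.
- by case=> [[[] []] []].
- by case=> [[[] []] []].
- by move=> f; apply: in_orbit.
- by move=> f; rewrite [sides _ _]pinched_face_orbit; case: f.
Qed.

(** * The unfolding *)

Local Notation unfolded := (unf pinched_map).

(** The first case is that of the sides of the pinched annulus: each one is now
followed by the side of the other circle that bounds the same bigon. *)
Lemma unf_nextE (d : dart pinched) : unf_next pinched_map d =
  let: (b, i, o) := d in
  if b == (i == o) then (~~ b, i, ~~ o) else (b, ~~ i, ~~ o).
Proof.
rewrite /unf_next; case: pickP => [[] | no_bigon].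
- rewrite [sides _ _](pinched_face_orbit true) /=.
  rewrite [orbit _ _](pinched_face_orbit true).
  by case: d => [[[] []] []].
- by rewrite ltnn.
- have := no_bigon true; rewrite /= [orbit _ _](pinched_face_orbit true).
  by case: d {no_bigon} => [[[] []] []].
Qed.

Lemma unf_next_orbit (d : dart pinched) :
  orbit (unf_next pinched_map) d = [:: d; unf_next pinched_map d].
Proof.
by apply: orbit_fcycle; rewrite /= !unf_nextE; case: d => [[[] []] []].
Qed.

Local Notation proj := (@unf_proj _ _ _ pinched_map).

(** Only the ends [Some true] and [Some false] of the two circles are merged, as
no gluing step relates the pinching point to another vertex. *)
Lemma connect_glueE (v w : option bool) :
  connect (glue pinched_map) v w = (isSome v == isSome w).
Proof.
apply/idP/eqP=> [|same].
  have glue_isSome : closed (glue pinched_map) (fun v => isSome v).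
    move=> x y /existsP[d]; rewrite /in_mem /= unf_nextE.
    by case: d => [[[] []] []] /orP[] /andP[/eqP-> /eqP->].
  by move/(closed_connect glue_isSome).
case: v w same => [b|] [b'|] //= _.
have [<- | neq] := eqVneq b b'; first exact: connect0.
apply/connect1/existsP; exists (b, b, true).
by rewrite unf_nextE; case: b b' neq => [] [].
Qed.

Lemma proj_eqE (v w : option bool) :
  (proj v == proj w) = (isSome v == isSome w).
Proof.
rewrite -val_eqE /= (root_connect (glue_connect_sym pinched_map)).
exact: connect_glueE.
Qed.

(** The representative of a class of glued vertices is chosen arbitrarily, so the
value of [proj] is known only through this invariant. *)
Lemma isSome_val_proj v : isSome (val (proj v)) = isSome v.
Proof. by apply/esym/eqP; rewrite -connect_glueE; apply: connect_root. Qed.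

Lemma val_projK : cancel val proj.
Proof. by move=> u; apply/val_inj/eqP/(valP u). Qed.

Lemma card_unfolded_vert : #|pvert unfolded| = 2.
Proof.
rewrite -[RHS]card_bool; apply: (bij_eq_card (f := fun u => isSome (val u))).
exists (fun b => proj (if b then Some true else None)) => [u | b].
  by rewrite -[RHS]val_projK; apply/eqP; rewrite proj_eqE; case: (val u).
by rewrite isSome_val_proj; case: b.
Qed.

Definition chain_bigon (t : 'I_2) : pface unfolded :=
  Tagged (fun s => 'I_(flength pinched_map s))
    (t : 'I_(flength pinched_map true)).

Definition hole_bigon : pface unfolded :=
  Tagged (fun s => 'I_(flength pinched_map s))
    (ord0 : 'I_(flength pinched_map false)).

Lemma unfolded_face_ind (P : pface unfolded -> Prop) :
    P (chain_bigon ord0) -> P (chain_bigon ord_max) -> P hole_bigon ->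
  forall f, P f.
Proof.
move=> P0 P1 Phole [[] t].
- have [t0 | t1] : t = ord0 :> 'I_2 \/ t = ord_max :> 'I_2.
  + by case: t => [[|[|k]] lt_k] //; [left | right]; apply: val_inj.
  + by rewrite t0; apply: P0.
  by rewrite t1; apply: P1.
- suff -> : t = ord0 :> 'I_1 by exact: Phole.
  exact: ord1.
Qed.

Lemma side_of_chain (t : 'I_2) : side_of (chain_bigon t) =
  if t == ord0 then (true, true, true) else (true, false, false).
Proof.
rewrite /side_of /= [sides _ _](pinched_face_orbit true).
by case: t => [[|[|k]] lt_k].
Qed.

Lemma unf_baseE (f : pface unfolded) : unf_base f =
  if ~~ tag f then (true, false, true)
  else if tagged f == 0 :> nat then (true, true, true)
  else (true, false, false).
Proof.
by elim/unfolded_face_ind: f; rewrite /unf_base ?side_of_chain.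
Qed.

Definition bigon_sides (f : pface unfolded) : seq (dart pinched) :=
  if ~~ tag f then [:: (true, false, true); (true, true, false)]
  else if tagged f == 0 :> nat then
    [:: (true, true, true); (false, true, false)]
  else [:: (true, false, false); (false, false, true)].

Lemma bigon_sidesE (f : pface unfolded) :
  orbit (@pnext unfolded) (pbase f) = bigon_sides f.
Proof.
rewrite /= unf_next_orbit unf_baseE /bigon_sides unf_nextE.
by case: (~~ _) => //; case: (_ == 0).
Qed.

Lemma unfolded_borders_None (d : dart unfolded) :
  borders d None = (d \in [:: (false, true, true); (false, false, false)]).
Proof.
apply/forallP/idP => [out | ext_d f]; last first.
  rewrite bigon_sidesE; move: ext_d.
  by elim/unfolded_face_ind: f; case: d => [[[] []] []].
have := (out hole_bigon, out (chain_bigon ord0), out (chain_bigon ord_max)).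
by rewrite !bigon_sidesE; case: d {out} => [[[] []] []] [[]].
Qed.

Lemma card_unfolded_face : #|pface unfolded| = 3.
Proof. by rewrite card_tagged sumnE big_map big_enum big_bool /= !card_ord. Qed.

(** Each of the three bigons makes two neighbouring edges parallel, and together
they relate all four. *)
Lemma unfolded_simply_connected : simply_connected unfolded.
Proof.
have par_hole : @parallel unfolded (true, false, true) (true, true, true).
  apply: (@parallel_bigon unfolded hole_bigon);
    by [apply/eqP; rewrite proj_eqE | apply: bigon_sidesE].
have par_first : @parallel unfolded (true, true, true) (false, true, true).
  apply: (@parallel_bigon unfolded (chain_bigon ord0));
    by [apply/eqP; rewrite proj_eqE | apply: bigon_sidesE].
have par_second : @parallel unfolded (true, false, true) (false, false, true).
  apply: (@parallel_opp unfolded (true, false, false) (false, false, false)).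
  apply: (@parallel_bigon unfolded (chain_bigon ord_max));
    by [apply/eqP; rewrite proj_eqE | apply: bigon_sidesE].
have par (e : pedge unfolded) :
    @parallel unfolded (e, true) (true, true, true).
  case: e => [[] []]; first exact: parallel_refl; first exact: par_hole.
    exact: parallel_sym.
  exact: parallel_trans (parallel_sym par_second) par_hole.
pose r (u : pvert unfolded) : seq (dart unfolded) :=
  if isSome (val u) then [:: (true, true, false)] else [::].
have r_proj v :
    r (proj v) = if isSome v then [:: (true, true, false)] else [::].
  by rewrite /r isSome_val_proj.
apply: (@simply_connected_retract unfolded (proj None) r) => [u | [b i]].
  rewrite -[u]val_projK r_proj; case: (val u) => [b|] //.
  by split; [apply/eqP; rewrite proj_eqE|].
rewrite [r _](r_proj (Some b)) [r _](r_proj None).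
exact: (homotopic_parallel (par (b, i))).
Qed.

Lemma unfolded_diagram : disk_diagram unfolded.
Proof.
split.
- by move=> [[[] []] []] [[[] []] []]; rewrite /= !unf_nextE.
- move=> d d'; rewrite [RHS]proj_eqE.
  pose rot (d : dart pinched) := let: (b, i, o) := d in
    if b == (i == ~~ o) then (~~ b, i, o) else (b, ~~ i, o).
  have rotE : (fun d => unf_next pinched_map (opp d)) =1 rot.
    by move=> [[[] []] []]; rewrite unf_nextE.
  rewrite (eq_fconnect rotE) fconnect_orbit.
  have -> : orbit rot d = [:: d; rot d; rot (rot d); rot (rot (rot d))].
    by case: d => [[[] []] []]; apply: orbit_fcycle.
  by case: d => [[[] []] []]; case: d' => [[[] []] []].
- move=> f g; rewrite fconnect_orbit bigon_sidesE /= unf_baseE.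
  by elim/unfolded_face_ind: f; elim/unfolded_face_ind: g.
- move=> d d'; rewrite !unfolded_borders_None fconnect_orbit.
  rewrite unf_next_orbit unf_nextE.
  by case: d => [[[] []] []] //; case: d' => [[[] []] []].
- by rewrite card_unfolded_vert card_unfolded_face card_prod card_bool.
- exact: unfolded_simply_connected.
- by move=> d /eqP; rewrite proj_eqE; case: d => [[[] []] []].
Qed.

Lemma unfolded_disk_map : disk_map (unf_map pinched_map).
Proof.
have startE (f : pface unfolded) : unf_fstart f =
    if ~~ tag f then (true, false, true)
    else if tagged f == 0 :> nat then (true, true, true)
    else (false, false, true).
  by elim/unfolded_face_ind: f; rewrite /unf_fstart ?side_of_chain ?unf_nextE.
split.
- exact: unfolded_diagram.
- by move=> d; rewrite /= isSome_val_proj; case: d => [[[] []] []].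
- by move=> d; case: d => [[[] []] []].
- move=> f; rewrite /borders bigon_sidesE /= startE.
  by elim/unfolded_face_ind: f.
- move=> f; rewrite /sides /= unf_next_orbit startE unf_nextE.
  by elim/unfolded_face_ind: f => //=; rewrite /unf_fmap ?side_of_chain.
Qed.

(** * A hole that only the unfolding opens *)

Lemma carrier1 (D : plane_complex) (f : pface D) (c : cell D) :
  (c \in carrier [set f]) =
  (c == rcell (Some f)) || incident c (rcell (Some f)).
Proof.
rewrite inE; apply/existsP/idP => [[g /andP[/set1P->]] // | c_f].
by exists f; rewrite inE eqxx.
Qed.

Lemma dual_connected1 (D : plane_complex) (f : pface D) :
  dual_connected [set f].
Proof. by move=> g h /set1P-> /set1P->; apply: connect0. Qed.

Lemma incident_edgeE (e : pedge unfolded) (f : pface unfolded) :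
  incident (ecell e) (rcell (Some f)) =
  ((e, true) \in bigon_sides f) || ((e, false) \in bigon_sides f).
Proof. by rewrite -!bigon_sidesE. Qed.

(** The cells outside of the carrier form a chain: the hole, the edge
[(true, false)], the second bigon, the edge [(false, false)], the exterior. *)
Lemma first_bigon_hole_free : hole_free [set chain_bigon ord0].
Proof.
set A := [set _].
have face_out f : (rcell (Some f) \notin carrier A) = (f != chain_bigon ord0).
  by rewrite carrier1 orbF.
have edge_out b : ecell ((b, false) : pedge unfolded) \notin carrier A.
  by rewrite carrier1 incident_edgeE; case: b.
have ext_out : rcell None \notin carrier A by rewrite carrier1.
pose step := [rel b b' : cell unfolded |
  [&& b \notin carrier A, b' \notin carrier A
    & incident b b' || incident b' b]].
have cross (c c' : cell unfolded) :
    c \notin carrier A -> c' \notin carrier A ->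
    incident c c' || incident c' c -> connect step c c'.
  by move=> c_out c'_out inc; apply/connect1/and3P.
have second_out : chain_bigon ord_max != chain_bigon ord0.
  by apply/eqP => /(congr1 (fun f : pface unfolded => nat_of_ord (tagged f))).
have from_outer_edge :
    connect step (ecell ((false, false) : pedge unfolded)) (rcell None).
  apply: cross => //; apply/orP; left.
  by rewrite [incident _ _]/(borders _ _ || borders _ _) !unfolded_borders_None.
have from_second :
    connect step (rcell (Some (chain_bigon ord_max))) (rcell None).
  apply: connect_trans from_outer_edge; apply: cross => //.
    by rewrite face_out.
  by rewrite incident_edgeE.
have from_hole_edge :
    connect step (ecell ((true, false) : pedge unfolded)) (rcell None).
  apply: connect_trans from_second; apply: cross => //.
    by rewrite face_out.
  by rewrite incident_edgeE.
move=> c c_out; case: c c_out => [[v | e] | [f | ]] c_out.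
- case/negP: c_out; rewrite carrier1 /=; apply/orP; left.
  apply/existsP; rewrite -[v]val_projK.
  have src_first (d : dart unfolded) : d \in bigon_sides (chain_bigon ord0) ->
      borders d (Some (chain_bigon ord0)).
    by rewrite -bigon_sidesE.
  (* [Some false] may or may not be the chosen representative, but its class is  *)
  (* the one of the vertex across from the pinching point.                       *)
  exists (if val v is None then (true, true, true) else (false, true, false)).
  rewrite proj_eqE; case: (val v) => [b|]; rewrite andbT; exact: src_first.
- case: e c_out => [b []]; last by case: b.
  by rewrite carrier1 incident_edgeE; case: b.
- elim/unfolded_face_ind: f c_out => //; first by rewrite face_out eqxx.
  move=> hole_out; apply: connect_trans from_hole_edge; apply: cross => //.
  by rewrite incident_edgeE.
- exact: connect0.
Qed.

Lemma coll_first_bigon :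
  coll [set chain_bigon ord0] = [set true : pface pinched].
Proof. by rewrite /coll imset_set1. Qed.

Lemma pinched_borders_Some (d : dart pinched) (f : pface pinched) :
  borders d (Some f) =
  (d \in if f then [:: (true, true, true); (true, false, false);
                       (false, false, true); (false, true, false)]
         else [:: (true, false, true); (true, true, false)]).
Proof. by rewrite -pinched_face_orbit. Qed.

(** Every cell in the frontier of the hole lies on the carrier of the pinched
annulus, so no chain of cells can leave the hole. *)
Lemma pinched_face_not_hole_free : ~ hole_free [set true : pface pinched].
Proof.
pose hole : cell pinched := @rcell pinched (Some false).
set A := [set _] => /(_ hole).
have shut (c : cell pinched) : incident c hole -> c \in carrier A.
  rewrite carrier1; case: c => [[v | e] | r] // c_hole; apply/orP; right.
    apply/orP; left; apply/existsP.
    (* The side of the annulus by which its boundary walk leaves [v]. *)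
    exists (if v is Some b then (b, ~~ b, false) else (true, true, true)).
    by rewrite pinched_borders_Some; case: v {c_hole} => [[]|].
  rewrite [incident _ _]/(borders _ _ || borders _ _) !pinched_borders_Some.
  move: c_hole.
  rewrite [incident _ _]/(borders _ _ || borders _ _) !pinched_borders_Some.
  by case: e => [[] []].
case/(_ _)/connectP=> [|[|c p] //= /andP[/and3P[_ c_out inc] _] _].
  by rewrite carrier1 orbF; apply/eqP; case.
by case/negP: c_out; apply: shut; case: c inc => [[v | e] | r].
Qed.

Theorem proposition4p54 :
  (exists (X : complex2) (D : plane_complex)
          (phi : cell_map D (path_completion 2 X))
          (A' : {set pface (unf phi)}),
     [/\ combinatorial_complex X, simply_connected X & locally_finite X] /\
     [/\ disk_map phi & disk_map (unf_map phi)] /\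
     [/\ A' <> set0, dual_connected A' & hole_free A'] /\
     dual_connected (coll A') /\ ~ hole_free (coll A')) /\
  ~ (forall (M : nat) (X : complex2) (D : plane_complex)
            (phi : cell_map D (path_completion M X))
            (A' : {set pface (unf phi)}),
       1 <= M ->
       combinatorial_complex X -> simply_connected X -> locally_finite X ->
       disk_map phi -> disk_map (unf_map phi) ->
       dual_connected A' -> hole_free A' -> hole_free (coll A')).
Proof.
have example :
  [/\ combinatorial_complex segment, simply_connected segment
    & locally_finite segment] /\
  [/\ disk_map pinched_map & disk_map (unf_map pinched_map)] /\
  [/\ [set chain_bigon ord0] <> set0, dual_connected [set chain_bigon ord0]
    & hole_free [set chain_bigon ord0]] /\
  dual_connected (coll [set chain_bigon ord0]) /\
  ~ hole_free (coll [set chain_bigon ord0]).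
  split; last split; last split; last split.
  - split; [exact: segment_combinatorial | exact: segment_simply_connected
           | exact: segment_locally_finite].
  - by split; [exact: pinched_disk_map | exact: unfolded_disk_map].
  - split; [| exact: dual_connected1 | exact: first_bigon_hole_free].
    by move/setP/(_ (chain_bigon ord0)); rewrite !inE eqxx.
  - by rewrite coll_first_bigon; apply: dual_connected1.
  - by rewrite coll_first_bigon; apply: pinched_face_not_hole_free.
split; first by exists segment, pinched, pinched_map, [set chain_bigon ord0].
case: example => [[? ? ?] [[? ?] [[_ ? ?] [_ not_hole_free]]]] hole_free_coll.
exact/not_hole_free/(hole_free_coll 2).
Qed.
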